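(* Let $(L,\theta_L)$ be a 3-LieDer pair, $n\ge0$ an integer, and let $(f_t,g_t)$ be a deformation of order $n$ of $(L,\theta_L)$. Then $(f_t,g_t)$ is extensible (to a deformation of order $n+1$) if and only if the cohomology class $[(\Omega^3_{n+1},\Omega^2_{n+1})]$ in $\mathcal H^3_{\rm 3-LieDer}(L;L)$ is trivial.
   Context: Throughout, $\mathbb F$ is an algebraically closed field of characteristic $0$ and all vector spaces (such as $L$) are finite-dimensional over $\mathbb F$. A 3-Lie algebra is a vector space $L$ with a skew-symmetric trilinear map $[\cdot,\cdot,\cdot]_L$ satisfying $[x_1,x_2,[x_3,x_4,x_5]]=[[x_1,x_2,x_3],x_4,x_5]+[x_3,[x_1,x_2,x_4],x_5]+[x_3,x_4,[x_1,x_2,x_5]]$. A derivation is a linear map $\theta_L:L\to L$ with $\theta_L[x,y,z]=[\theta_L x,y,z]+[x,\theta_L y,z]+[x,y,\theta_L z]$. A 3-LieDer pair $(L,\theta_L)$ is a 3-Lie algebra together with a derivation. Cohomology with coefficients in the adjoint representation $(V;\rho,\theta_V)=(L;\mathrm{ad},\theta_L)$, $\mathrm{ad}(x,y)z=[x,y,z]_L$: put $C^1(L;V)=\mathrm{Hom}(L,V)$ and, for $p\ge2$, $C^p(L;V)=\mathrm{Hom}(\otimes^{p-1}(\wedge^2L)\wedge L,V)$, i.e. linear maps $\alpha(\mathfrak X_1,\dots,\mathfrak X_{p-1},z)$, $\mathfrak X_i=x_i\wedge y_i\in\wedge^2L$, $z\in L$, totally skew-symmetric in the last three arguments $x_{p-1},y_{p-1},z$.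 On $\wedge^2L$ let $[x_1\wedge x_2,y_1\wedge y_2]_F=[x_1,x_2,y_1]_L\wedge y_2+y_1\wedge[x_1,x_2,y_2]_L$ and $\theta_L(x\wedge y)=\theta_L(x)\wedge y+x\wedge\theta_L(y)$. Define $\mathrm d:C^p(L;V)\to C^{p+1}(L;V)$ by $$\begin{aligned}(\mathrm df)(\mathfrak X_1,\dots,\mathfrak X_p,z)=&\sum_{1\le j<k\le p}(-1)^jf(\mathfrak X_1,\dots,\widehat{\mathfrak X_j},\dots,\mathfrak X_{k-1},[\mathfrak X_j,\mathfrak X_k]_F,\mathfrak X_{k+1},\dots,\mathfrak X_p,z)\\&+\sum_{j=1}^p(-1)^jf(\mathfrak X_1,\dots,\widehat{\mathfrak X_j},\dots,\mathfrak X_p,[x_j,y_j,z]_L)+\sum_{j=1}^p(-1)^{j+1}\rho(\mathfrak X_j)f(\mathfrak X_1,\dots,\widehat{\mathfrak X_j},\dots,\mathfrak X_p,z)\\&+(-1)^{p+1}\rho(y_p,z)f(\mathfrak X_1,\dots,\mathfrak X_{p-1},x_p)+(-1)^p\rho(x_p,z)f(\mathfrak X_1,\dots,\mathfrak X_{p-1},y_p),\end{aligned}$$ and $\delta:C^p(L;V)\to C^p(L;V)$ by $(\delta\alpha)(\mathfrak X_1,\dots,\mathfrak X_{p-1},z)=\sum_{i=1}^{p-1}\alpha(\mathfrak X_1,\dots,\theta_L(\mathfrak X_i),\dots,\mathfrak X_{p-1},z)+\alpha(\mathfrak X_1,\dots,\mathfrak X_{p-1},\theta_L(z))-\theta_V(\alpha(\mathfrak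 X_1,\dots,\mathfrak X_{p-1},z))$. Set $\mathcal C^1_{\rm 3-LieDer}(L;V)=\mathrm{Hom}(L,V)$, $\mathcal C^p_{\rm 3-LieDer}(L;V)=C^p(L;V)\times C^{p-1}(L;V)$ for $p\ge2$, with coboundary $\partial\alpha_1=(\mathrm d\alpha_1,-\delta\alpha_1)$ and $\partial(\alpha_p,\beta_{p-1})=(\mathrm d\alpha_p,\mathrm d\beta_{p-1}+(-1)^p\delta\alpha_p)$ for $p\ge2$. $\mathcal H^p_{\rm 3-LieDer}(L;V)$ denotes its $p$-th cohomology (cocycles modulo coboundaries). A deformation of order $n$ of $(L,\theta_L)$ is a pair $f_t=\sum_{i=0}^nf_it^i$, $g_t=\sum_{i=0}^ng_it^i$ with $f_i\in\mathrm{Hom}(\wedge^3L,L)$, $g_i\in\mathrm{Hom}(L,L)$, $(f_0,g_0)=([\cdot,\cdot,\cdot]_L,\theta_L)$, that endows the $\mathbb F[[t]]/(t^{n+1})$-module $L[[t]]/(t^{n+1})$ with the structure of a 3-LieDer pair. It is extensible if there is a 2-cochain $(f_{n+1},g_{n+1})\in\mathcal C^2_{\rm 3-LieDer}(L;L)$ such that $(f_t+f_{n+1}t^{n+1},\,g_t+g_{n+1}t^{n+1})$ is a deformation of order $n+1$. Define the 3-cochain $(\Omega^3_{n+1},\Omega^2_{n+1})\in\mathcal C^3_{\rm 3-LieDer}(L;L)$ by, for $X_1=x_1\wedge x_2$, $X_2=x_3\wedge x_4$, $x_5\in L$, $$\Omega^3_{n+1}(X_1,X_2,x_5)=\sum_{\substack{i+j=n+1\\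 i,j>0}}\Big(f_i(f_j(x_1,x_2,x_3),x_4,x_5)+f_i(x_3,f_j(x_1,x_2,x_4),x_5)+f_i(x_3,x_4,f_j(x_1,x_2,x_5))-f_i(x_1,x_2,f_j(x_3,x_4,x_5))\Big),$$ $$\Omega^2_{n+1}(X_1,x_3)=\sum_{\substack{i+j=n+1\\ i,j>0}}\Big(g_i(f_j(x_1,x_2,x_3))-f_j(g_i(x_1),x_2,x_3)-f_j(x_1,g_i(x_2),x_3)-f_j(x_1,x_2,g_i(x_3))\Big).$$ This cochain is a 3-cocycle, hence has a cohomology class. *)

(* Defs.v *)
From HB Require Import structures.
From mathcomp Require Import all_boot all_algebra.
From mathcomp Require Import boolp classical_sets functions.

Set Implicit Arguments.
Unset Strict Implicit.
Unset Printing Implicit Defensive.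

Import GRing.Theory.

Local Open Scope classical_set_scope.
Local Open Scope ring_scope.

(* The ground ring R is arbitrary so that the same definition applies to L over
   the field F and to L[[t]]/(t^n.+1) over F[[t]]/(t^n.+1). *)
Section LieDer3.
Variables (R : comNzRingType) (M : lmodType R).
Implicit Types (br : M -> M -> M -> M) (th : M -> M).

Definition trilinear br :=
  [/\ forall y z, linear (fun x => br x y z),
      forall x z, linear (fun y => br x y z)
    & forall x y, linear (fun z => br x y z)].

(* The two transpositions generate the symmetric group on the arguments; as 2
   is invertible in the rings considered below, skew-symmetric maps are the
   same as alternating ones, i.e. maps on the exterior power. *)
Definition skew_symmetric br :=
  (forall x y z, br y x z = - br x y z) /\
  (forall x y z, br x z y = - br x y z).

Definition fundamental_identity br := forall x1 x2 x3 x4 x5,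
  br x1 x2 (br x3 x4 x5) =
  br (br x1 x2 x3) x4 x5 + br x3 (br x1 x2 x4) x5 + br x3 x4 (br x1 x2 x5).

Definition is_3Lie br :=
  [/\ trilinear br, skew_symmetric br & fundamental_identity br].

Definition is_derivation br th := linear th /\
  forall x y z, th (br x y z) = br (th x) y z + br x (th y) z + br x y (th z).

Definition is_3LieDer br th := is_3Lie br /\ is_derivation br th.

End LieDer3.

(* The ring F[[t]]/(t^n.+1) is {poly %/ 'X^n.+1}, and an element
   u_0 + u_1 t + ... + u_n t^n of the module L[[t]]/(t^n.+1) over it is given
   by its coefficients. *)
Definition truncmod (F : fieldType) (L : lmodType F) (n : nat) :=
  {ffun 'I_n.+1 -> L}.

Section TruncatedModule.
Variables (F : fieldType) (L : lmodType F) (n : nat).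
Local Notation Rn := {poly %/ ('X^(n.+1) : {poly F})}.
Local Notation Ln := (truncmod L n).
Implicit Types (a b : Rn) (u v : Ln).

HB.instance Definition _ := GRing.Zmodule.on Ln.

Definition trunc_scale a u : Ln :=
  [ffun k : 'I_n.+1 =>
    \sum_(i < n.+1) \sum_(j < n.+1 | (i + j == k)%N) (a : {poly F})`_i *: u j].

Lemma coef_truncM a b (s : 'I_n.+1) :
  (a * b : {poly F})`_s =
  \sum_(i < n.+1) \sum_(l < n.+1 | (i + l == s)%N)
    (a : {poly F})`_i * (b : {poly F})`_l.
Proof.
have -> : (a * b : {poly F})`_s = ((a : {poly F}) * (b : {poly F}))`_s.
  rewrite poly_of_qpolyM; move: (polyn a * polyn b) => p; rewrite mk_monic_Xn /=.
  have mX : 'X^(n.+1) \is @monic F by exact: monicXn.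
  by rewrite {2}(Pdiv.RingMonic.rdivp_eq mX p) coefD coefMXn ltn_ord add0r.
rewrite coefM (big_ord_widen n.+1 (fun i => (a : {poly F})`_i * b`_(s - i))) //.
rewrite big_mkcond; apply: eq_bigr => i _; rewrite ltnS.
case: leqP => [le_is|lt_si].
  rewrite (big_pred1 (inord (s - i))) => [|l].
    by rewrite inordK // ltnS (leq_trans (leq_subr _ _)) // -ltnS.
  rewrite /= -(inj_eq val_inj) /= inordK; first by rewrite -[RHS](eqn_add2l i) subnKC.
  by rewrite ltnS (leq_trans (leq_subr _ _)) // -ltnS.
rewrite big_pred0 // => l; apply/negbTE; rewrite neq_ltn.
by rewrite (leq_trans lt_si (leq_addr _ _)) orbT.
Qed.

Lemma sum_trunc_pred1 (V : nmodType) (x : V) (i m : nat) (k : 'I_n.+1) :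
  \sum_(s < n.+1 | (i + s == k)%N && (m == s)%N) x =
  if (i + m == k)%N then x else 0.
Proof.
case: eqP => [eq_k|ne_k]; last first.
  by rewrite big_pred0 // => s; apply/negbTE/andP => -[/eqP e /eqP m_s]; apply: ne_k; rewrite m_s.
have lt_m : (m < n.+1)%N by rewrite (leq_ltn_trans _ (ltn_ord k)) // -eq_k leq_addl.
rewrite (big_pred1 (Ordinal lt_m)) // => s.
rewrite /= -(inj_eq val_inj) /= [RHS]eq_sym.
by case: (m =P s) => [<-|_]; rewrite ?andbF // eq_k eqxx.
Qed.

Fact trunc_scaleA a b u : trunc_scale a (trunc_scale b u) = trunc_scale (a * b) u.
Proof.
apply/ffunP => k; rewrite !ffunE.
pose T (i l m : 'I_n.+1) :=
  if (i + (l + m) == k)%N then ((a : {poly F})`_i * (b : {poly F})`_l) *: u m else 0.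
transitivity (\sum_i \sum_l \sum_m T i l m).
  apply: eq_bigr => i _.
  under eq_bigr => j _.
    rewrite ffunE scaler_sumr; under eq_bigr do rewrite scaler_sumr big_mkcond.
    over.
  rewrite exchange_big; apply: eq_bigr => l _.
  rewrite exchange_big; apply: eq_bigr => m _.
  rewrite -big_mkcondr sum_trunc_pred1 /T.
  by case: ifP => // _; rewrite scalerA.
transitivity (\sum_(s < n.+1) \sum_(m < n.+1 | (s + m == k)%N)
    \sum_(i < n.+1) \sum_(l < n.+1 | (i + l == s)%N)
      ((a : {poly F})`_i * (b : {poly F})`_l) *: u m); last first.
  apply: eq_bigr => s _; apply: eq_bigr => m _; rewrite coef_truncM scaler_suml.
  by apply: eq_bigr => i _; rewrite scaler_suml.
under [RHS]eq_bigr => s _ do rewrite big_mkcond /=.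
rewrite [RHS]exchange_big /=.
have E (s m : 'I_n.+1) : (if (s + m == k)%N then
    \sum_(i < n.+1) \sum_(l < n.+1 | (i + l == s)%N)
      ((a : {poly F})`_i * (b : {poly F})`_l) *: u m else 0) =
    \sum_(i < n.+1) \sum_(l < n.+1) if (m + s == k)%N && (i + l == s)%N then
      ((a : {poly F})`_i * (b : {poly F})`_l) *: u m else 0.
  rewrite addnC; case: ifP => _ /=; last by rewrite big1 // => i _; rewrite big1.
  by apply: eq_bigr => i _; rewrite big_mkcond.
under [RHS]eq_bigr => m _.
  under eq_bigr do rewrite E.
  rewrite exchange_big /=.
  under eq_bigr => i _.
    rewrite exchange_big /=.
    under eq_bigr do rewrite -big_mkcond sum_trunc_pred1.
    over.
  over.
rewrite [RHS]exchange_big; apply: eq_bigr => i _.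
rewrite [RHS]exchange_big; apply: eq_bigr => l _.
by apply: eq_bigr => m _; rewrite /T [(m + _)%N]addnC addnA.
Qed.

Fact trunc_scale1 : left_id 1 trunc_scale.
Proof.
move=> u; apply/ffunP => k; rewrite !ffunE (bigD1 ord0) //= [X in _ + X]big1.
  rewrite addr0 (big_pred1 k) => [|j]; last by rewrite add0n.
  by rewrite /= coefC scale1r.
move=> i i_neq0; rewrite big1 // => j _.
by rewrite /= coefC (negbTE (i_neq0 : (i : nat) != 0)) scale0r.
Qed.

Fact trunc_scaleDr : right_distributive trunc_scale +%R.
Proof.
move=> a u v; apply/ffunP => k; rewrite !ffunE -big_split; apply: eq_bigr => i _.
by rewrite -big_split; apply: eq_bigr => j _; rewrite ffunE scalerDr.
Qed.

Fact trunc_scaleDl u : {morph trunc_scale^~ u : a b / a + b}.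
Proof.
move=> a b; apply/ffunP => k; rewrite !ffunE -big_split; apply: eq_bigr => i _.
by rewrite -big_split; apply: eq_bigr => j _; rewrite coefD scalerDl.
Qed.

HB.instance Definition _ := GRing.Zmodule_isLmodule.Build Rn Ln
  trunc_scaleA trunc_scale1 trunc_scaleDr trunc_scaleDl.

End TruncatedModule.

Section TruncatedExtension.
Variables (F : fieldType) (L : lmodType F) (n : nat).

(* The F[[t]]/(t^n.+1)-multilinear extensions of f_0 + f_1 t + ... + f_n t^n
   and g_0 + g_1 t + ... + g_n t^n to L[[t]]/(t^n.+1). *)
Definition trunc_bracket (f : 'I_n.+1 -> L -> L -> L -> L)
    (u v w : truncmod L n) : truncmod L n :=
  [ffun k : 'I_n.+1 => \sum_(i < n.+1) \sum_(a < n.+1) \sum_(b < n.+1)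
    \sum_(c < n.+1 | (i + a + b + c == k)%N) f i (u a) (v b) (w c)].

Definition trunc_map (g : 'I_n.+1 -> L -> L) (u : truncmod L n) :
    truncmod L n :=
  [ffun k : 'I_n.+1 =>
    \sum_(i < n.+1) \sum_(a < n.+1 | (i + a == k)%N) g i (u a)].

End TruncatedExtension.

(* cochain L q encodes C^q.+1(L;L): the q elements of \wedge^2 L are
   represented by pairs (x, y) standing for x \wedge y, and linearity on \wedge^2 L
   becomes bilinearity and skew-symmetry in (x, y). *)
Definition cochain (F : fieldType) (L : lmodType F) (q : nat) :=
  ('I_q -> L * L) -> L -> L.

Section Cochains.
Variables (F : fieldType) (L : lmodType F).

Definition is_cochain q (f : cochain L q) :=
  [/\ forall X, linear (f X),
      forall X k z,
        [/\ forall y, linear (fun x => f [eta X with k |-> (x, y)] z),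
            forall x, linear (fun y => f [eta X with k |-> (x, y)] z)
          & forall x y, f [eta X with k |-> (y, x)] z =
                        - f [eta X with k |-> (x, y)] z]
    & forall X (k : 'I_q) x y z, k.+1 = q ->
        f [eta X with k |-> (x, z)] y = - f [eta X with k |-> (x, y)] z].

Definition omit q (j : 'I_q.+1) (X : 'I_q.+1 -> L * L) : 'I_q -> L * L :=
  fun i => X (lift j i).

Variables (br : L -> L -> L -> L) (th : L -> L).

(* Elements of \wedge^2 L that are sums of x \wedge y's are represented by the list
   of the corresponding pairs; cochains are then summed over that list. *)
Definition wedge_bracket (X Y : L * L) : seq (L * L) :=
  [:: (br X.1 X.2 Y.1, Y.2); (Y.1, br X.1 X.2 Y.2)].

Definition wedge_der (X : L * L) : seq (L * L) :=
  [:: (th X.1, X.2); (X.1, th X.2)].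

Definition ad (X : L * L) (z : L) : L := br X.1 X.2 z.

(* The indices j, k start from 0 here, whence the exponents j.+1 for the usual
   (-1)^j; the degree of f is p = q.+1. *)
Definition codiff q (f : cochain L q) : cochain L q.+1 := fun X z =>
  let Xp := X ord_max in
  \sum_(j < q.+1) \sum_(k < q.+1 | (j < k)%N)
    (-1) ^+ j.+1 *: \sum_(W <- wedge_bracket (X j) (X k))
                      f (omit j [eta X with k |-> W]) z
  + \sum_(j < q.+1) (-1) ^+ j.+1 *: f (omit j X) (ad (X j) z)
  + \sum_(j < q.+1) (-1) ^+ j.+2 *: ad (X j) (f (omit j X) z)
  + (-1) ^+ q.+2 *: ad (Xp.2, z) (f (omit ord_max X) Xp.1)
  + (-1) ^+ q.+1 *: ad (Xp.1, z) (f (omit ord_max X) Xp.2).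

Definition delta q (f : cochain L q) : cochain L q := fun X z =>
  \sum_(i < q) \sum_(W <- wedge_der (X i)) f [eta X with i |-> W] z
  + f X (th z) - th (f X z).

(* der_cochain q encodes C^p(L;L) * C^p.-1(L;L) for p = q.+2; only degrees
   p >= 2 are involved in the cohomology groups of degree at least 3. *)
Definition der_cochain q : Type := (cochain L q.+1 * cochain L q)%type.

Definition is_der_cochain q (c : der_cochain q) :=
  is_cochain c.1 /\ is_cochain c.2.

Definition partial q (c : der_cochain q) : der_cochain q.+1 :=
  (codiff c.1, codiff c.2 + (-1) ^+ q.+2 *: delta c.1).

Definition cocycles q : set (der_cochain q) :=
  [set c | is_der_cochain c /\ partial c = 0].

Definition coboundaries q : set (der_cochain q.+1) :=
  [set partial b | b in @is_der_cochain q].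

(* The class of c in the cohomology group of degree q.+3, as a coset: the set
   of all cocycles that differ from c by a coboundary. *)
Definition cohomology_class q (c : der_cochain q.+1) : set (der_cochain q.+1) :=
  [set c' | @cocycles q.+1 c' /\ @coboundaries q (c' - c)].

End Cochains.

Section Deformations.
Variables (F : fieldType) (L : lmodType F).
Variables (br : L -> L -> L -> L) (th : L -> L).

Definition is_deformation n (f : 'I_n.+1 -> L -> L -> L -> L)
    (g : 'I_n.+1 -> L -> L) :=
  [/\ forall i, trilinear (f i) /\ skew_symmetric (f i),
      forall i, linear (g i),
      f ord0 = br /\ g ord0 = th
    & is_3LieDer (R := {poly %/ ('X^(n.+1) : {poly F})})
        (trunc_bracket f) (trunc_map g)].

Definition append n (T : Type) (s : 'I_n.+1 -> T) (x : T) : 'I_n.+2 -> T :=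
  fun i => if unlift ord_max i is Some j then s j else x.

Definition cochain2 (f : L -> L -> L -> L) : cochain L 1 :=
  fun X z => f (X ord0).1 (X ord0).2 z.

Definition cochain1 (g : L -> L) : cochain L 0 := fun _ z => g z.

Definition extensible n (f : 'I_n.+1 -> L -> L -> L -> L)
    (g : 'I_n.+1 -> L -> L) :=
  exists (f' : L -> L -> L -> L) (g' : L -> L),
    @is_der_cochain F L 0 (cochain2 f', cochain1 g') /\
    is_deformation (append f f') (append g g').

Definition Omega3 n (f : 'I_n.+1 -> L -> L -> L -> L) : cochain L 2 :=
  fun X x5 =>
    let: (x1, x2) := X ord0 in
    let: (x3, x4) := X ord_max in
    \sum_(i < n.+1) \sum_(j < n.+1 | [&& 0 < i, 0 < j & i + j == n.+1]%N)
      (f i (f j x1 x2 x3) x4 x5 + f i x3 (f j x1 x2 x4) x5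
       + f i x3 x4 (f j x1 x2 x5) - f i x1 x2 (f j x3 x4 x5)).

Definition Omega2 n (f : 'I_n.+1 -> L -> L -> L -> L)
    (g : 'I_n.+1 -> L -> L) : cochain L 1 :=
  fun X x3 =>
    let: (x1, x2) := X ord0 in
    \sum_(i < n.+1) \sum_(j < n.+1 | [&& 0 < i, 0 < j & i + j == n.+1]%N)
      (g i (f j x1 x2 x3) - f j (g i x1) x2 x3
       - f j x1 (g i x2) x3 - f j x1 x2 (g i x3)).

Definition Omega n (f : 'I_n.+1 -> L -> L -> L -> L) (g : 'I_n.+1 -> L -> L) :
    der_cochain L 1 :=
  (Omega3 f, Omega2 f g).

End Deformations.

(* Main.v *)
Require Import Defs.
From HB Require Import structures.
From mathcomp Require Import all_boot all_algebra.
From mathcomp Require Import boolp classical_sets functions.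
From mathcomp Require Import zify.

Import GRing.Theory.
Local Open Scope classical_set_scope.
Local Open Scope ring_scope.

(** A deformation of order n extended by (f', g') is again a deformation if and
    only if its bracket and its map satisfy the fundamental identity and the
    Leibniz rule over L[[t]]/(t^(n+2)).  Both defects are multiadditive, and
    L[[t]]/(t^(n+2)) is additively generated by the monomials x t^m; on
    monomials the defects are shifts of the convolutions
      sum over i + j = k of obstr3 (f_i) (f_j),
      sum over i + j = k of obstr2 (g_i) (f_j).
    So the fundamental identity and the Leibniz rule say that these vanish for
    k <= n + 1 (trunc_3LieDerP).  For k <= n they do not involve (f', g') and
    vanish by the hypothesis on (f_t, g_t).  For k = n + 1 the terms with 0 < i
    and 0 < j are the cochain Omega, and the remaining terms, where (f', g')
    meets the bracket and the derivation of L, add up to minus the coboundary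
    of (f', g'); skew-symmetry of the bracket brings the last two terms of the
    coboundary into the form in which they occur in the defect.  Hence (f', g')
    extends the deformation if and only if its coboundary is Omega
    (append_deformationP).

    As every pair of cochains of degrees 2 and 1 has the form of such an
    (f', g'), extensibility means that Omega is a coboundary (extensibleP).
    Since 0 is a cocycle and coboundaries form a group, the class of a cochain
    is that of 0 exactly when it is a coboundary
    (cohomology_class_trivial). *)

Set Implicit Arguments.
Unset Strict Implicit.
Unset Printing Implicit Defensive.

(** * Multiadditive maps and the two defects *)

Notation additive_map E := {morph E : u v / u + v}.

Section AdditiveMaps.
Variables (U V : zmodType) (E : U -> V).
Hypothesis addE : additive_map E.

Lemma additive_map0 : E 0 = 0.
Proof. by apply: (addrI (E 0)); rewrite -addE !addr0. Qed.

Lemma additive_mapN u : E (- u) = - E u.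
Proof. by apply: (addrI (E u)); rewrite -addE !subrr additive_map0. Qed.

Lemma additive_map_sum I (r : seq I) (P : pred I) (u : I -> U) :
  E (\sum_(i <- r | P i) u i) = \sum_(i <- r | P i) E (u i).
Proof. exact: (big_morph E addE additive_map0). Qed.

End AdditiveMaps.

Definition triadditive (U V : zmodType) (br : U -> U -> U -> V) :=
  [/\ forall y z, additive_map (fun x => br x y z),
      forall x z, additive_map (fun y => br x y z)
    & forall x y, additive_map (fun z => br x y z)].

Section Obstructions.
Variable V : zmodType.
Implicit Types (A B : V -> V -> V -> V) (G : V -> V).

(** The polarized defect of the fundamental identity: the identity for a
    bracket A is the vanishing of obstr3 A A, and the mixed terms obstr3 A B
    occur in the expansion of the defect of a sum of brackets. *)
Definition obstr3 A B x1 x2 x3 x4 x5 :=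
  A (B x1 x2 x3) x4 x5 + A x3 (B x1 x2 x4) x5 + A x3 x4 (B x1 x2 x5)
  - A x1 x2 (B x3 x4 x5).

Definition obstr2 G B x1 x2 x3 :=
  G (B x1 x2 x3) - B (G x1) x2 x3 - B x1 (G x2) x3 - B x1 x2 (G x3).

Let addrACA4 (a b c d a' b' c' d' : V) :
  (a + a') + (b + b') + (c + c') + (d + d') =
  (a + b + c + d) + (a' + b' + c' + d').
Proof. by rewrite (addrACA a) (addrACA (a + b)) (addrACA (a + b + c)). Qed.

Lemma obstr3D A B : triadditive A -> triadditive B ->
  [/\ forall x2 x3 x4 x5, additive_map (fun x1 => obstr3 A B x1 x2 x3 x4 x5),
      forall x1 x3 x4 x5, additive_map (fun x2 => obstr3 A B x1 x2 x3 x4 x5),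
      forall x1 x2 x4 x5, additive_map (fun x3 => obstr3 A B x1 x2 x3 x4 x5),
      forall x1 x2 x3 x5, additive_map (fun x4 => obstr3 A B x1 x2 x3 x4 x5)
    & forall x1 x2 x3 x4, additive_map (obstr3 A B x1 x2 x3 x4)].
Proof.
move=> [A1 A2 A3] [B1 B2 B3].
by split=> ? ? ? ? u v; rewrite /obstr3 ?(B1, B2, B3) ?(A1, A2, A3) opprD addrACA4.
Qed.

Lemma obstr2D G B : additive_map G -> triadditive B ->
  triadditive (obstr2 G B).
Proof.
move=> GD [B1 B2 B3].
by split=> ? ? u v; rewrite /obstr2 ?GD ?(B1, B2, B3) ?GD !opprD addrACA4.
Qed.

End Obstructions.

Section Linear.
Variables (R : comNzRingType) (M : lmodType R).
Implicit Types (br : M -> M -> M -> M) (th : M -> M).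

Lemma additive_linear (N N' : lmodType R) (h : N -> N') : linear h -> additive_map h.
Proof. by move=> lin_h u v; rewrite -[u]scale1r lin_h !scale1r. Qed.

Lemma linear0_map (N N' : lmodType R) (h : N -> N') : linear h -> h 0 = 0.
Proof. by move=> /additive_linear /additive_map0. Qed.

Lemma linearZ_map (N N' : lmodType R) (h : N -> N') :
  linear h -> forall a u, h (a *: u) = a *: h u.
Proof. by move=> h_lin a u; rewrite -[a *: u]addr0 h_lin (linear0_map h_lin) addr0. Qed.

Lemma triadditive_trilinear br : trilinear br -> triadditive br.
Proof. by case=> b1 b2 b3; split=> *; apply: additive_linear. Qed.

(** Transpositions carry linearity in the first argument to the other two. *)
Lemma skew_trilinear br : skew_symmetric br ->
  (forall y z, linear (fun x => br x y z)) -> trilinear br.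
Proof.
move=> [s12 s23] lin1.
have lin2 x z : linear (fun y => br x y z).
  by move=> a u v; rewrite s12 lin1 opprD -scalerN -!s12.
by split=> // x y a u v; rewrite s23 lin2 opprD -scalerN -!s23.
Qed.

Lemma fundamental_identityE br :
  fundamental_identity br <-> forall x1 x2 x3 x4 x5, obstr3 br br x1 x2 x3 x4 x5 = 0.
Proof.
split=> H x1 x2 x3 x4 x5; first by rewrite /obstr3 -H subrr.
by apply/esym/subr0_eq/H.
Qed.

Lemma derivationE br th :
  (forall x y z, th (br x y z) = br (th x) y z + br x (th y) z + br x y (th z)) <->
  forall x y z, obstr2 th br x y z = 0.
Proof.
have obstr2E x y z : obstr2 th br x y z =
    th (br x y z) - (br (th x) y z + br x (th y) z + br x y (th z)).
  by rewrite !opprD !addrA.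
split=> H x y z; first by rewrite obstr2E H subrr.
by apply: subr0_eq; rewrite -obstr2E.
Qed.

End Linear.

(** * Monomials of L[[t]]/(t^(n+1)) *)

Section Monomials.
Variables (F : fieldType) (L : lmodType F) (n : nat).
Local Notation Ln := (truncmod L n).
Local Notation Rn := {poly %/ ('X^(n.+1) : {poly F})}.
Implicit Types (x y z : L) (u v w : Ln).

(** The monomial x t^m; the degree m is any natural number, so that degrees add
    up without side conditions, and the monomial is 0 for m > n. *)
Definition mono (m : nat) x : Ln := [ffun k : 'I_n.+1 => if k == m :> nat then x else 0].

Lemma monoD m : additive_map (mono m).
Proof. by move=> x y; apply/ffunP=> k; rewrite !ffunE; case: ifP; rewrite ?addr0. Qed.

Lemma mono_decomp u : u = \sum_(a < n.+1) mono a (u a).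
Proof.
apply/ffunP=> k; rewrite sum_ffunE (bigD1 k) //= ffunE eqxx big1 ?addr0 // => i ik.
by rewrite ffunE ifN // eq_sym.
Qed.

Lemma mono_ext (V : zmodType) (E1 E2 : Ln -> V) :
  additive_map E1 -> additive_map E2 ->
  (forall m x, E1 (mono m x) = E2 (mono m x)) -> forall u, E1 u = E2 u.
Proof.
move=> D1 D2 E12 u; rewrite [u]mono_decomp !additive_map_sum //.
by apply: eq_bigr.
Qed.

(** Serves for skew-symmetry, for the Leibniz rule, and for homogeneity of the
    truncated bracket under scalars of F[[t]]/(t^(n+1)). *)
Lemma mono_ext3 (V : zmodType) (E1 E2 : Ln -> Ln -> Ln -> V) :
  triadditive E1 -> triadditive E2 ->
  (forall a b c x y z, E1 (mono a x) (mono b y) (mono c z) =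
                       E2 (mono a x) (mono b y) (mono c z)) ->
  forall u v w, E1 u v w = E2 u v w.
Proof.
move=> [D1 D2 D3] [D1' D2' D3'] E12 u v w.
apply: (mono_ext (D1 _ _) (D1' _ _)) => a x.
apply: (mono_ext (D2 _ _) (D2' _ _)) => b y.
by apply: (mono_ext (D3 _ _) (D3' _ _)) => c z.
Qed.

Lemma scale_mono (a : Rn) m x :
  a *: mono m x = \sum_(p < n.+1) mono (p + m) ((a : {poly F})`_p *: x).
Proof.
apply/ffunP=> k; rewrite ffunE sum_ffunE; apply: eq_bigr => p _; rewrite ffunE.
have [e|ne] := eqVneq (k : nat) (p + m)%N.
  have lt_m : (m < n.+1)%N by rewrite (leq_ltn_trans _ (ltn_ord k)) // e leq_addl.
  rewrite (big_pred1 (Ordinal lt_m)) ?ffunE ?eqxx // => j.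
  by rewrite /= e eqn_add2l.
rewrite big1 // => j /eqP e; rewrite ffunE ifN ?scaler0 //.
by apply: contra ne => /eqP <-; rewrite e.
Qed.

End Monomials.

(** * Truncated 3-LieDer pairs in terms of their coefficients *)

Section TruncCriterion.
Variables (F : fieldType) (L : lmodType F) (n : nat).
Local Notation Ln := (truncmod L n).
Local Notation Rn := {poly %/ ('X^(n.+1) : {poly F})}.
Local Notation mono := (mono n).
Variables (f : 'I_n.+1 -> L -> L -> L -> L) (g : 'I_n.+1 -> L -> L).
Hypothesis f_tri : forall i, trilinear (f i).
Hypothesis g_lin : forall i, linear (g i).
Local Notation bt := (trunc_bracket f).
Local Notation gt := (trunc_map g).

Let f_add i : triadditive (f i).
Proof. exact: triadditive_trilinear. Qed.

Lemma trunc_bracketD : triadditive bt.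
Proof.
have f1 i y z : additive_map (fun x => f i x y z) by case: (f_add i).
have f2 i x z : additive_map (fun y => f i x y z) by case: (f_add i).
have f3 i x y : additive_map (f i x y) by case: (f_add i).
by split=> [v w|u w|u v] t t'; apply/ffunP => k; rewrite !ffunE;
  do 4![rewrite -big_split; apply: eq_bigr => ? _ /=];
  rewrite ffunE ?(f1, f2, f3).
Qed.

Lemma trunc_mapD : additive_map gt.
Proof.
move=> u v; apply/ffunP => k; rewrite !ffunE.
rewrite -big_split; apply: eq_bigr => i _ /=.
rewrite -big_split; apply: eq_bigr => a _.
by rewrite ffunE (additive_linear (g_lin i)).
Qed.

Lemma trunc_map_mono a x : gt (mono a x) = \sum_(i < n.+1) mono (i + a) (g i x).
Proof.
apply/ffunP=> k; rewrite ffunE sum_ffunE; apply: eq_bigr => i _; rewrite ffunE.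
have [e|ne] := eqVneq (k : nat) (i + a)%N.
  have lt_a : (a < n.+1)%N by rewrite (leq_ltn_trans _ (ltn_ord k)) // e leq_addl.
  rewrite (big_pred1 (Ordinal lt_a)) ?ffunE ?eqxx // => j.
  by rewrite /= e eqn_add2l.
rewrite big1 // => j /eqP e; rewrite ffunE ifN ?(linear0_map (g_lin i)) //.
by apply: contra ne => /eqP <-; rewrite e.
Qed.

(** The summation condition of trunc_bracket leaves the degrees a, b, c of the
    arguments as the only contribution to the coefficient of each f_i. *)
Lemma trunc_bracket_mono a b c x y z :
  bt (mono a x) (mono b y) (mono c z) =
  \sum_(i < n.+1) mono (i + a + b + c) (f i x y z).
Proof.
apply/ffunP=> k; rewrite ffunE sum_ffunE; apply: eq_bigr => i _; rewrite ffunE.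
case: (f_tri i) => l1 l2 l3.
have f0 a' b' c' :
    f i (mono a x a') (mono b y b') (mono c z c') =
    if [&& a' == a :> nat, b' == b :> nat & c' == c :> nat] then f i x y z else 0.
  rewrite !ffunE; case: eqP => _; last exact: linear0_map (l1 _ _).
  case: eqP => _; last exact: linear0_map (l2 _ _).
  by case: eqP => _; last exact: linear0_map (l3 _ _).
have [e|ne] := eqVneq (k : nat) (i + a + b + c)%N; last first.
  rewrite big1 // => a' _; rewrite big1 // => b' _; rewrite big1 // => c' /eqP e'.
  rewrite f0 ifN //; apply: contra ne => /and3P[/eqP <- /eqP <- /eqP <-].
  by rewrite e'.
have le_k m : (m <= k)%N -> (m < n.+1)%N by move=> /leq_ltn_trans; apply.
have lt_a : (a < n.+1)%N by apply: le_k; rewrite e -!addnA addnCA leq_addr.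
have lt_b : (b < n.+1)%N by apply: le_k; rewrite e -addnA addnCA leq_addr.
have lt_c : (c < n.+1)%N by apply: le_k; rewrite e leq_addl.
rewrite (bigD1 (Ordinal lt_a)) //= [X in _ + X]big1 ?addr0; last first.
  move=> a' ne_a; rewrite big1 // => b' _; rewrite big1 // => c' _.
  by rewrite f0 (negbTE (ne_a : a' != a :> nat)).
rewrite (bigD1 (Ordinal lt_b)) //= [X in _ + X]big1 ?addr0; last first.
  move=> b' ne_b; rewrite big1 // => c' _.
  by rewrite f0 (negbTE (ne_b : b' != b :> nat)) andbF.
rewrite (big_pred1 (Ordinal lt_c)) ?f0 /= ?eqxx // => c'.
by rewrite /= e eqn_add2l.
Qed.

Lemma trunc_bracket_skew :
  (forall i, skew_symmetric (f i)) -> skew_symmetric bt.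
Proof.
move=> f_skew; case: trunc_bracketD => D1 D2 D3.
have btND : triadditive (fun u v w => - bt u v w).
  by split=> ? ? ? ?; rewrite ?(D1, D2, D3) opprD.
split.
  move=> u v w; apply: (mono_ext3 (E1 := fun u v w => bt v u w) _ btND) => //.
  move=> a b c x y z; rewrite !trunc_bracket_mono -sumrN; apply: eq_bigr => i _.
  by rewrite [(i + b + a)%N]addnAC (f_skew i).1 (additive_mapN (@monoD _ _ _ _)).
move=> u v w; apply: (mono_ext3 (E1 := fun u v w => bt u w v) _ btND) => //.
move=> a b c x y z; rewrite !trunc_bracket_mono -sumrN; apply: eq_bigr => i _.
by rewrite [(i + a + c + b)%N]addnAC (f_skew i).2 (additive_mapN (@monoD _ _ _ _)).
Qed.

Lemma trunc_bracket_linear1 v w : linear (fun u => bt u v w : Ln).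
Proof.
have [D1 D2 D3] := trunc_bracketD.
move=> r u u'; rewrite D1; congr (_ + _).
apply: (mono_ext3 (E1 := fun u v w => bt (r *: u) v w)
                  (E2 := fun u v w => r *: bt u v w)).
- by split=> ? ? ? ?; rewrite ?scalerDr ?(D1, D2, D3).
- by split=> ? ? ? ?; rewrite ?(D1, D2, D3) scalerDr.
move=> a b c x y z; rewrite scale_mono (additive_map_sum (D1 _ _)).
rewrite trunc_bracket_mono scaler_sumr.
under [RHS]eq_bigr do rewrite scale_mono.
under [LHS]eq_bigr do rewrite trunc_bracket_mono.
rewrite exchange_big; apply: eq_bigr => i _; apply: eq_bigr => p _.
by case: (f_tri i) => l1 _ _; rewrite (linearZ_map (l1 _ _)) [(i + (p + a))%N]addnCA !addnA.
Qed.

Lemma trunc_map_linear : linear (gt : Ln -> Ln).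
Proof.
move=> r u u'; rewrite trunc_mapD; congr (_ + _).
apply: (mono_ext (E1 := fun u => gt (r *: u)) (E2 := fun u => r *: gt u)).
- by move=> ? ?; rewrite scalerDr trunc_mapD.
- by move=> ? ?; rewrite trunc_mapD scalerDr.
move=> a x; rewrite scale_mono (additive_map_sum trunc_mapD).
rewrite trunc_map_mono scaler_sumr.
under [RHS]eq_bigr do rewrite scale_mono.
under [LHS]eq_bigr do rewrite trunc_map_mono.
rewrite exchange_big; apply: eq_bigr => i _; apply: eq_bigr => p _.
by rewrite (linearZ_map (g_lin i)) addnCA.
Qed.

Definition obstr3_coef k x1 x2 x3 x4 x5 :=
  \sum_(i < n.+1) \sum_(j < n.+1 | (i + j == k)%N) obstr3 (f i) (f j) x1 x2 x3 x4 x5.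

Definition obstr2_coef k x1 x2 x3 :=
  \sum_(i < n.+1) \sum_(j < n.+1 | (i + j == k)%N) obstr2 (g i) (f j) x1 x2 x3.

Lemma obstr3_mono a b c d e x1 x2 x3 x4 x5 :
  obstr3 bt bt (mono a x1) (mono b x2) (mono c x3) (mono d x4) (mono e x5) =
  \sum_(i < n.+1) \sum_(j < n.+1)
    mono (i + j + (a + b + c + d + e)) (obstr3 (f i) (f j) x1 x2 x3 x4 x5).
Proof.
have [D1 D2 D3] := trunc_bracketD.
pose s := (a + b + c + d + e)%N.
rewrite /obstr3 !trunc_bracket_mono.
rewrite (additive_map_sum (D1 _ _)) (additive_map_sum (D2 _ _)) !(additive_map_sum (D3 _ _)).
pose S (h : 'I_n.+1 -> 'I_n.+1 -> L) : Ln :=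
  \sum_(i < n.+1) \sum_(j < n.+1) mono (i + j + s) (h i j).
have nested (B : 'I_n.+1 -> Ln) h :
    (forall j, B j = \sum_(i < n.+1) mono (i + j + s) (h i j)) ->
    \sum_(j < n.+1) B j = S h.
  by move=> BE; rewrite /S exchange_big; apply: eq_bigr => j _; rewrite BE.
transitivity (S (fun i j => f i (f j x1 x2 x3) x4 x5)
    + S (fun i j => f i x3 (f j x1 x2 x4) x5)
    + S (fun i j => f i x3 x4 (f j x1 x2 x5))
    - S (fun i j => f i x1 x2 (f j x3 x4 x5))).
  by congr (_ + _ + _ - _); apply: nested => j; rewrite trunc_bracket_mono;
    apply: eq_bigr => i _; congr (mono _ _); rewrite /s; lia.
rewrite -!big_split -sumrB; apply: eq_bigr => i _.
rewrite -!big_split -sumrB; apply: eq_bigr => j _ /=.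
by rewrite -!monoD -(additive_mapN (@monoD _ _ _ _)) -monoD.
Qed.

Lemma obstr2_mono a b c x1 x2 x3 :
  obstr2 gt bt (mono a x1) (mono b x2) (mono c x3) =
  \sum_(i < n.+1) \sum_(j < n.+1)
    mono (i + j + (a + b + c)) (obstr2 (g i) (f j) x1 x2 x3).
Proof.
have [D1 D2 D3] := trunc_bracketD.
pose s := (a + b + c)%N.
rewrite /obstr2 !trunc_map_mono trunc_bracket_mono.
rewrite (additive_map_sum (D1 _ _)) (additive_map_sum (D2 _ _)) (additive_map_sum (D3 _ _)).
rewrite (additive_map_sum trunc_mapD).
pose S (h : 'I_n.+1 -> 'I_n.+1 -> L) : Ln :=
  \sum_(i < n.+1) \sum_(j < n.+1) mono (i + j + s) (h i j).
transitivity (S (fun i j => g i (f j x1 x2 x3)) - S (fun i j => f j (g i x1) x2 x3)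
    - S (fun i j => f j x1 (g i x2) x3) - S (fun i j => f j x1 x2 (g i x3))).
  congr (_ - _ - _ - _); rewrite /S; first rewrite exchange_big /=;
    by apply: eq_bigr => i _; rewrite ?trunc_map_mono ?trunc_bracket_mono;
       apply: eq_bigr => j _; congr (mono _ _); rewrite /s; lia.
rewrite -!sumrB; apply: eq_bigr => i _; rewrite -!sumrB; apply: eq_bigr => j _ /=.
by rewrite -!(additive_mapN (@monoD _ _ _ _)) -!monoD.
Qed.

(** The coefficient of t^k in a shift by t^s is a convolution of degree k - s,
    hence of degree at most n; higher convolutions are truncated away. *)
Lemma coef_sum_mono s (h : 'I_n.+1 -> 'I_n.+1 -> L) (k : 'I_n.+1) :
  (\sum_(i < n.+1) \sum_(j < n.+1) mono (i + j + s) (h i j)) k =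
  if (s <= k)%N then \sum_(i < n.+1) \sum_(j < n.+1 | (i + j == k - s)%N) h i j else 0.
Proof.
rewrite sum_ffunE; under eq_bigr do rewrite sum_ffunE.
case: leqP => [le_sk|lt_ks].
  apply: eq_bigr => i _; rewrite [RHS]big_mkcond; apply: eq_bigr => j _.
  by rewrite ffunE eq_sym -[RHS](congr1 (fun b : bool => if b then _ else _) (eqn_add2r s _ _)) subnK.
rewrite big1 // => i _; rewrite big1 // => j _; rewrite ffunE ifN //.
by rewrite neq_ltn (leq_trans lt_ks) // leq_addl.
Qed.

(** One direction evaluates the defects at constants, whose coefficients are
    the convolutions; the other reduces to monomials, on which the defects are
    shifts of these convolutions. *)
Lemma trunc_3LieDerP : (forall i, skew_symmetric (f i)) ->
  is_3LieDer (R := Rn) bt gt <->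
  (forall k, (k < n.+1)%N ->
     (forall x1 x2 x3 x4 x5, obstr3_coef k x1 x2 x3 x4 x5 = 0) /\
     (forall x1 x2 x3, obstr2_coef k x1 x2 x3 = 0)).
Proof.
move=> f_skew; split=> [[[_ _ FI] [_ Der]] k lt_k|obstr0].
  split=> [x1 x2 x3 x4 x5|x1 x2 x3].
    have /fundamental_identityE/(_ (mono 0 x1) (mono 0 x2) (mono 0 x3) (mono 0 x4) (mono 0 x5)) := FI.
    by rewrite obstr3_mono => /ffunP/(_ (Ordinal lt_k)); rewrite coef_sum_mono subn0 ffunE.
  have /derivationE/(_ (mono 0 x1) (mono 0 x2) (mono 0 x3)) := Der.
  by rewrite obstr2_mono => /ffunP/(_ (Ordinal lt_k)); rewrite coef_sum_mono subn0 ffunE.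
have skew_bt := trunc_bracket_skew f_skew.
have add0 : additive_map (fun _ : Ln => 0 : Ln) by move=> ? ?; rewrite addr0.
split; split=> //.
- exact: (skew_trilinear (R := Rn) skew_bt trunc_bracket_linear1).
- apply/(fundamental_identityE (R := Rn)).
  have [D1 D2 D3 D4 D5] := obstr3D trunc_bracketD trunc_bracketD.
  move=> u1 u2 u3 u4 u5.
  apply: (mono_ext (D1 _ _ _ _) add0) => a x1.
  apply: (mono_ext (D2 _ _ _ _) add0) => b x2.
  apply: (mono_ext (D3 _ _ _ _) add0) => c x3.
  apply: (mono_ext (D4 _ _ _ _) add0) => d x4.
  apply: (mono_ext (D5 _ _ _ _) add0) => e x5.
  rewrite obstr3_mono; apply/ffunP=> k; rewrite coef_sum_mono ffunE.
  by case: ifP => // _; apply: (obstr0 _ (leq_ltn_trans (leq_subr _ _) (ltn_ord k))).1.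
- exact: trunc_map_linear.
apply/(derivationE (R := Rn)).
apply: (mono_ext3 (obstr2D trunc_mapD trunc_bracketD) (E2 := fun _ _ _ => 0)) => //.
move=> a b c x1 x2 x3; rewrite obstr2_mono; apply/ffunP=> k; rewrite coef_sum_mono ffunE.
by case: ifP => // _; apply: (obstr0 _ (leq_ltn_trans (leq_subr _ _) (ltn_ord k))).2.
Qed.

End TruncCriterion.

(** * Convolutions of a sequence with one more term *)

Section Append.
Variables (n : nat) (T : Type) (s : 'I_n.+1 -> T) (x : T).

Lemma append_max : append s x ord_max = x.
Proof. by rewrite /append unlift_none. Qed.

Lemma append_widen (i : 'I_n.+1) : append s x (widen_ord (leqnSn n.+1) i) = s i.
Proof.
have -> : widen_ord (leqnSn n.+1) i = lift ord_max i.
  by apply/val_inj; rewrite /= -[RHS]/(lift ord_max i : nat) lift_max.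
by rewrite /append liftK.
Qed.

Lemma append0 : append s x ord0 = s ord0.
Proof. by rewrite -append_widen; congr append; apply/val_inj. Qed.

End Append.

Section AppendConvolution.
Variables (n : nat) (T U : Type) (V : nmodType).
Variables (s : 'I_n.+1 -> T) (s' : 'I_n.+1 -> U) (x : T) (x' : U) (H : T -> U -> V).

(** The added terms have index n + 1, too large to occur below that degree. *)
Lemma append_convolution_lt k : (k < n.+1)%N ->
  \sum_(i < n.+2) \sum_(j < n.+2 | (i + j == k)%N) H (append s x i) (append s' x' j) =
  \sum_(i < n.+1) \sum_(j < n.+1 | (i + j == k)%N) H (s i) (s' j).
Proof.
move=> lt_k; rewrite big_ord_recr /= [X in _ + X]big1 ?addr0; last first.
  by move=> j /eqP e; move: lt_k; rewrite -e ltnNge leq_addr.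
apply: eq_bigr => i _; rewrite big_mkcond big_ord_recr /= ifN ?addr0; last first.
  by apply: contraTneq lt_k => <-; rewrite -leqNgt leq_addl.
by rewrite -big_mkcond /=; apply: eq_bigr => j _; rewrite !append_widen.
Qed.

(** In degree n + 1 an added term pairs with the term of index 0 only. *)
Lemma append_convolution_top :
  \sum_(i < n.+2) \sum_(j < n.+2 | (i + j == n.+1)%N) H (append s x i) (append s' x' j) =
  \sum_(i < n.+1) \sum_(j < n.+1 | [&& 0 < i, 0 < j & i + j == n.+1]%N) H (s i) (s' j)
  + H (s ord0) x' + H x (s' ord0).
Proof.
rewrite big_ord_recr /=; congr (_ + _); last first.
  rewrite append_max (big_pred1 ord0) ?append0 // => j.
  by rewrite /= -(inj_eq val_inj) /=; lia.
have -> : H (s ord0) x' = \sum_(i < n.+1 | i == ord0) H (s i) x'.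
  by rewrite big_pred1_eq.
rewrite [X in _ = _ + X]big_mkcond -big_split; apply: eq_bigr => i _ /=.
rewrite big_mkcond big_ord_recr /= append_max append_widen.
congr (_ + _); last first.
  suff -> : (i + n.+1 == n.+1)%N = (i == ord0) by [].
  by rewrite -(inj_eq val_inj) /=; lia.
rewrite [RHS]big_mkcond; apply: eq_bigr => j _; rewrite append_widen.
(* As i, j <= n, neither index can vanish if i + j = n + 1. *)
suff -> : [&& 0 < i, 0 < j & i + j == n.+1]%N = (i + j == n.+1)%N by [].
by move: (ltn_ord i) (ltn_ord j); lia.
Qed.

End AppendConvolution.

(** * The coboundary of a 2-cochain *)

Section LowDegreeCochains.
Variables (F : fieldType) (L : lmodType F).
Variables (br : L -> L -> L -> L) (th : L -> L).

Lemma is_cochain2P (f : L -> L -> L -> L) :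
  is_cochain (cochain2 f) <-> trilinear f /\ skew_symmetric f.
Proof.
split=> [[l3 l12 s23]|[[l1 l2 l3] [s12 s23]]].
  split; last split=> x y z.
  - split=> [y z|x z|x y].
    + by have [l1 _ _] := l12 (fun=> (0, 0)) ord0 z; exact: (l1 y).
    + by have [_ l2 _] := l12 (fun=> (0, 0)) ord0 z; exact: (l2 x).
    + exact: (l3 (fun=> (x, y))).
  - by have [_ _ s12] := l12 (fun=> (0, 0)) ord0 z; exact: s12.
  - exact: (s23 (fun=> (0, 0)) ord0 x y z).
split=> [X|X k z|X k x y z _]; first exact: l3.
  by rewrite [k]ord1; split=> [y|x|x y]; [exact: l1|exact: l2|exact: s12].
by rewrite [k]ord1; exact: s23.
Qed.

Lemma is_cochain1P (g : L -> L) : is_cochain (cochain1 g) <-> linear g.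
Proof.
split=> [[+ _ _]|lin_g]; first by apply; case.
by split=> [X|X []|X []].
Qed.

Lemma cochain2_surj (b : cochain L 1) : b = cochain2 (fun x y z => b (fun=> (x, y)) z).
Proof.
apply/funext=> X; apply/funext=> z; rewrite /cochain2 -surjective_pairing.
by congr (b _ z); apply/funext=> i; rewrite [i]ord1.
Qed.

Lemma cochain1_surj (b : cochain L 0) : b = cochain1 (b (fun=> (0, 0))).
Proof.
apply/funext=> X; apply/funext=> z; rewrite /cochain1.
by congr (b _ z); apply/funext=> -[].
Qed.

Hypothesis skew_br : skew_symmetric br.

Let rot_br x y z : br y z x = br x y z.
Proof. by rewrite skew_br.2 skew_br.1 opprK. Qed.

(** The eight terms on both sides agree once the last two of the differential,
    br x4 z (f x1 x2 x3) and br x3 z (f x1 x2 x4), are rearranged by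
    skew-symmetry. *)
Lemma codiff_cochain2 f (X : 'I_2 -> L * L) z :
  codiff br (cochain2 f) X z =
  - (obstr3 br f (X ord0).1 (X ord0).2 (X ord_max).1 (X ord_max).2 z
     + obstr3 f br (X ord0).1 (X ord0).2 (X ord_max).1 (X ord_max).2 z).
Proof.
have lift01 : lift ord0 ord0 = ord_max :> 'I_2 by apply/val_inj.
have lift10 : lift ord_max ord0 = ord0 :> 'I_2 by apply/val_inj.
rewrite /codiff; do 6!rewrite ?big_mkcond ?big_ord_recl ?big_ord0 /=.
rewrite /wedge_bracket /cochain2 /omit /ad /= ?big_cons ?big_nil /= !lift01 !lift10 /=.
rewrite /bump /= !exprS expr0 !mulN1r ?opprK !scaleN1r !scale1r !(add0r, addr0) /obstr3.
case: (X ord0) (X ord_max) => [x1 x2] [x3 x4] /=.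
rewrite [\sum_(k < 2 | _) _]big_pred0 ?addr0; last by move=> [[|[|]]].
rewrite (rot_br (f x1 x2 x3)) (skew_br.2 x3 _ z) !(opprD, opprK) !addrA.
by rewrite [LHS](ACl (7*8*6*5*1*2*3*4)).
Qed.

Lemma codiff_cochain1 f g (X : 'I_1 -> L * L) z :
  (codiff br (cochain1 g) + (-1) ^+ 2 *: delta th (cochain2 f)) X z =
  - (obstr2 th f (X ord0).1 (X ord0).2 z + obstr2 g br (X ord0).1 (X ord0).2 z).
Proof.
have max0 : ord_max = ord0 :> 'I_1 by apply/val_inj.
rewrite !fctE /codiff /delta; do 4!rewrite ?big_mkcond ?big_ord_recl ?big_ord0 /=.
rewrite /wedge_der /cochain1 /cochain2 /ad /= ?big_cons ?big_nil /= max0.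
rewrite !exprS expr0 !mulN1r ?opprK !scaleN1r !scale1r !(add0r, addr0) /obstr2.
case: (X ord0) => [x1 x2] /=.
rewrite (rot_br (g x1)) (skew_br.2 x1 _ z) !(opprD, opprK) !addrA.
by rewrite [LHS](ACl (8*5*6*7*1*3*4*2)).
Qed.

End LowDegreeCochains.

(** * Coboundaries and the trivial class *)

Section Coboundaries.
Variables (F : fieldType) (L : lmodType F).
Variables (br : L -> L -> L -> L) (th : L -> L).
Hypotheses (br_tri : triadditive br) (thD : additive_map th).

Lemma is_cochain0 q : is_cochain (0 : cochain L q).
Proof.
have lin0 : linear (fun _ : L => 0 : L) by move=> ? ? ?; rewrite scaler0 addr0.
by split=> [X|X k z|X k x y z _]; rewrite ?oppr0 //; split=> [y|x|x y] //; rewrite oppr0.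
Qed.

Lemma is_cochainB q (f f' : cochain L q) :
  is_cochain f -> is_cochain f' -> is_cochain (f - f').
Proof.
have linB (h h' : L -> L) : linear h -> linear h' -> linear (fun x => h x - h' x).
  by move=> lin_h lin_h' a u v; rewrite lin_h lin_h' scalerBr opprD addrACA.
move=> [l3 l12 s23] [l3' l12' s23']; split=> [X|X k z|X k x y z kq].
- exact: linB (l3 X) (l3' X).
- have [l1 l2 s12] := l12 X k z; have [l1' l2' s12'] := l12' X k z.
  split=> [y|x|x y]; first exact: linB (l1 y) (l1' y).
    exact: linB (l2 x) (l2' x).
  by rewrite !fctE s12 s12' opprD.
by rewrite !fctE s23 // s23' // opprD.
Qed.

Lemma codiffD q : additive_map (@codiff F L br q).
Proof.
move=> f f'; apply/funext=> X; apply/funext=> z; rewrite !fctE /codiff /ad.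
have [_ _ b3] := br_tri.
have -> : \sum_(j < q.+1) \sum_(k < q.+1 | (j < k)%N) (-1) ^+ j.+1 *:
      \sum_(W <- wedge_bracket br (X j) (X k))
        (f + f') (omit j [eta X with k |-> W]) z =
    \sum_(j < q.+1) \sum_(k < q.+1 | (j < k)%N) (-1) ^+ j.+1 *:
      \sum_(W <- wedge_bracket br (X j) (X k)) f (omit j [eta X with k |-> W]) z
    + \sum_(j < q.+1) \sum_(k < q.+1 | (j < k)%N) (-1) ^+ j.+1 *:
      \sum_(W <- wedge_bracket br (X j) (X k)) f' (omit j [eta X with k |-> W]) z.
  rewrite -big_split; apply: eq_bigr => j _; rewrite -big_split; apply: eq_bigr => k _ /=.
  by rewrite -scalerDr -big_split.
have distr (s : nat -> F) (h h' : 'I_q.+1 -> L) :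
    \sum_(j < q.+1) s j *: (h j + h' j) =
    \sum_(j < q.+1) s j *: h j + \sum_(j < q.+1) s j *: h' j.
  by rewrite -big_split; apply: eq_bigr => j _; rewrite scalerDr.
under [X in _ + X + _ + _]eq_bigr do rewrite b3.
rewrite !b3 !(distr (fun j => (-1) ^+ j.+1)) !(distr (fun j => (-1) ^+ j.+2)) !scalerDr.
by rewrite [RHS]addrACA [X in _ = X + _]addrACA [X in _ = X + _ + _]addrACA
  [X in _ = X + _ + _ + _]addrACA.
Qed.

Lemma deltaD q : additive_map (@delta F L th q).
Proof.
move=> f f'; apply/funext=> X; apply/funext=> z; rewrite !fctE /delta thD opprD.
rewrite [RHS]addrACA [X in _ = X + _]addrACA -big_split; congr (_ + _ + _).
by apply: eq_bigr => i _; rewrite -big_split.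
Qed.

Lemma partialB q (b b' : der_cochain L q) :
  partial br th (b - b') = partial br th b - partial br th b'.
Proof.
have subE (V W : zmodType) (h : V -> W) : additive_map h -> {morph h : u v / u - v}.
  by move=> hD u v; rewrite hD additive_mapN.
rewrite /partial /= !(subE _ _ _ (@codiffD _)) (subE _ _ _ (@deltaD _)) scalerBr.
by rewrite addrACA -opprD.
Qed.

Lemma partial0 q : partial br th (0 : der_cochain L q) = 0.
Proof. by rewrite -(subrr 0) partialB subrr. Qed.

Lemma coboundaries0 q : coboundaries br th (q := q) 0.
Proof. by exists 0; rewrite ?partial0 //; split; exact: is_cochain0. Qed.

Lemma coboundariesB q (c c' : der_cochain L q.+1) :
  coboundaries br th c -> coboundaries br th c' -> coboundaries br th (c - c').
Proof.
move=> [b [b1 b2] <-] [b' [b1' b2'] <-]; exists (b - b'); last exact: partialB.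
by split; exact: is_cochainB.
Qed.

(** Left to right, 0 is a cocycle and lies in its own class, hence in that of c,
    so that - c is a coboundary. *)
Lemma cohomology_class_trivial q (c : der_cochain L q.+1) :
  cohomology_class br th c = cohomology_class br th 0 <-> coboundaries br th c.
Proof.
split=> [class_c|cob_c].
  have [] : cohomology_class br th c 0.
    rewrite class_c; split; last by rewrite subrr; exact: coboundaries0.
    by split; [split; exact: is_cochain0|exact: partial0].
  move=> _ /(coboundariesB (@coboundaries0 q)).
  by rewrite sub0r sub0r opprK.
apply/seteqP; split=> c' [cocycle_c']; rewrite ?subr0 => cob_c'; split=> //.
  rewrite subr0 -[c'](subrK c) -[X in _ + X]opprK; apply: coboundariesB => //.
  by rewrite -sub0r; apply: coboundariesB => //; exact: coboundaries0.
exact: coboundariesB.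
Qed.

End Coboundaries.

(** * Extending a deformation by one order *)

Section Extension.
Variables (F : fieldType) (L : lmodType F).
Variables (br : L -> L -> L -> L) (th : L -> L) (n : nat).
Variables (f : 'I_n.+1 -> L -> L -> L -> L) (g : 'I_n.+1 -> L -> L).
Hypothesis skew_br : skew_symmetric br.
Hypothesis def_fg : is_deformation br th f g.

Lemma append_obstr3_top f' (X : 'I_2 -> L * L) z :
  obstr3_coef (append f f') n.+1 (X ord0).1 (X ord0).2 (X ord_max).1 (X ord_max).2 z =
  Omega3 f X z - codiff br (cochain2 f') X z.
Proof.
have [_ _ [f0 _] _] := def_fg.
rewrite codiff_cochain2 // opprK -f0 addrA /obstr3_coef.
rewrite (append_convolution_top _ _ _ _
  (fun A B => obstr3 A B (X ord0).1 (X ord0).2 (X ord_max).1 (X ord_max).2 z)).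
by rewrite /Omega3; case: (X ord0) (X ord_max) => [? ?] [? ?].
Qed.

Lemma append_obstr2_top f' g' (X : 'I_1 -> L * L) z :
  obstr2_coef (append f f') (append g g') n.+1 (X ord0).1 (X ord0).2 z =
  Omega2 f g X z -
  (codiff br (cochain1 g') + (-1) ^+ 2 *: delta th (cochain2 f')) X z.
Proof.
have [_ _ [f0 g0] _] := def_fg.
rewrite codiff_cochain1 // opprK -f0 -g0 addrA /obstr2_coef.
rewrite (append_convolution_top _ _ _ _ (fun G B => obstr2 G B (X ord0).1 (X ord0).2 z)).
by rewrite /Omega2; case: (X ord0).
Qed.

(** Only the convolutions of degree n + 1 differ from those of (f, g), and they
    vanish exactly when the coboundary of (f', g') is Omega. *)
Lemma append_deformationP f' g' :
  is_der_cochain (q := 0) (cochain2 f', cochain1 g') ->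
  is_deformation br th (append f f') (append g g') <->
  Omega f g = partial br th (q := 0) (cochain2 f', cochain1 g').
Proof.
have [f_ok g_ok [f0 g0]] := def_fg.
move=> /(trunc_3LieDerP (fun i => (f_ok i).1) g_ok (fun i => (f_ok i).2)) obstr_lt.
move=> [/is_cochain2P f'_ok /is_cochain1P g'_ok].
have F_ok i : trilinear (append f f' i) /\ skew_symmetric (append f f' i).
  by rewrite /append; case: unlift.
have G_ok i : linear (append g g' i) by rewrite /append; case: unlift.
have crit := trunc_3LieDerP (fun i => (F_ok i).1) G_ok (fun i => (F_ok i).2).
split=> [[_ _ _ /crit/(_ _ (ltnSn _))[top3 top2]]|Omega_eq].
  rewrite /Omega /partial /=; congr (_, _); apply/funext=> X; apply/funext=> z.
    by apply: subr0_eq; rewrite -append_obstr3_top.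
  by apply: subr0_eq; rewrite -append_obstr2_top.
split=> //; first by rewrite !append0.
apply/crit => k; rewrite ltnS leq_eqVlt => /orP[/eqP ->|lt_k].
  case: Omega_eq => Omega3E Omega2E; split=> [x1 x2 x3 x4 x5|x1 x2 x3].
    have := append_obstr3_top f' (fun i => if i == ord0 then (x1, x2) else (x3, x4)) x5.
    by rewrite /= Omega3E subrr.
  by have := append_obstr2_top f' g' (fun=> (x1, x2)) x3; rewrite /= Omega2E subrr.
have [low3 low2] := obstr_lt k lt_k.
split=> *; rewrite /obstr3_coef /obstr2_coef.
  rewrite (append_convolution_lt _ _ _ _ (fun A B => obstr3 A B _ _ _ _ _)) //.
  exact: low3.
rewrite (append_convolution_lt _ _ _ _ (fun G B => obstr2 G B _ _ _)) //.
exact: low2.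
Qed.

Lemma extensibleP : extensible br th f g <-> coboundaries br th (q := 0) (Omega f g).
Proof.
split=> [[f' [g' [fg'_ok /(append_deformationP fg'_ok) ->]]]|].
  by exists (cochain2 f', cochain1 g').
move=> [[b1 b2]]; rewrite [b1]cochain2_surj [b2]cochain1_surj => b_ok /esym bE.
exists (fun x y z => b1 (fun=> (x, y)) z), (b2 (fun=> (0, 0))); split=> //.
exact/append_deformationP.
Qed.

End Extension.

Theorem theorem3p2 (F : closedFieldType) (charF0 : [pchar F] =i pred0)
  (L : vectType F) (br : L -> L -> L -> L) (th : L -> L)
  (LieDer_L : is_3LieDer br th) (n : nat)
  (f : 'I_n.+1 -> L -> L -> L -> L) (g : 'I_n.+1 -> L -> L)
  (def_fg : is_deformation br th f g) :
  extensible br th f g <->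
  cohomology_class br th (Omega f g) = cohomology_class br th 0.
Proof.
have [[br_tri skew_br _] [th_lin _]] := LieDer_L.
apply: iff_trans (extensibleP skew_br def_fg) _; apply: iff_sym.
apply: cohomology_class_trivial; last exact: additive_linear.
exact: triadditive_trilinear.
Qed.
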